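(* Let $(\mathbb{X},\mathcal{X},\mu,T)$ be a probability space with $T$ an invertible, measure-preserving, ergodic transformation, let $f:\mathbb{X}\to\mathbb{R}$ be measurable and let $q$ be a fixed integer. Then $$\mu\Big(\bigcup_{N>0}\bigcap_{n>N}\{f\circ T^{-n}<f\circ T^{n+q}\}\Big)=0,$$ i.e. the set of points $x$ for which $f(T^{-n}x)<f(T^{n+q}x)$ holds for all sufficiently large $n$ is $\mu$-negligible. (In particular, for $q=0$: $\mu\big(\bigcup_{N>0}\bigcap_{n>N}\{f\circ T^{-n}<f\circ T^{n}\}\big)=0$.) *)

(* Defs.v *)
From Stdlib Require Import Reals ZArith.
Open Scope R_scope.

Definition is_sigma_algebra {X : Type} (M : (X -> Prop) -> Prop) : Prop :=
  M (fun _ => True) /\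
  (forall A, M A -> M (fun x => ~ A x)) /\
  (forall A : nat -> X -> Prop, (forall n, M (A n)) ->
     M (fun x => exists n, A n x)).

(* mu is a probability measure on the measurable space (X, M).
   mu is a total function on sets; only its values on M matter. *)
Definition is_probability_measure {X : Type} (M : (X -> Prop) -> Prop)
    (mu : (X -> Prop) -> R) : Prop :=
  (forall A, M A -> 0 <= mu A) /\
  mu (fun _ => False) = 0 /\
  (forall A : nat -> X -> Prop,
     (forall n, M (A n)) ->
     (forall i j, i <> j -> forall x, A i x -> A j x -> False) ->
     infinite_sum (fun n => mu (A n)) (mu (fun x => exists n, A n x))) /\
  mu (fun _ => True) = 1.

Definition preimage {X Y : Type} (g : X -> Y) (A : Y -> Prop) : X -> Prop :=
  fun x => A (g x).

Definition measurable_map {X : Type} (M : (X -> Prop) -> Prop) (g : X -> X) : Prop :=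
  forall A, M A -> M (preimage g A).

Definition invertible_measurable {X : Type} (M : (X -> Prop) -> Prop)
    (T Tinv : X -> X) : Prop :=
  (forall x, Tinv (T x) = x) /\ (forall x, T (Tinv x) = x) /\
  measurable_map M T /\ measurable_map M Tinv.

Definition measure_preserving {X : Type} (M : (X -> Prop) -> Prop)
    (mu : (X -> Prop) -> R) (T : X -> X) : Prop :=
  forall A, M A -> mu (preimage T A) = mu A.

Definition ergodic {X : Type} (M : (X -> Prop) -> Prop)
    (mu : (X -> Prop) -> R) (T : X -> X) : Prop :=
  forall A, M A -> (forall x, preimage T A x <-> A x) ->
    mu A = 0 \/ mu A = 1.

Definition measurable_fun {X : Type} (M : (X -> Prop) -> Prop) (f : X -> R) : Prop :=
  forall a : R, M (fun x => f x < a).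

Definition Tpow {X : Type} (T Tinv : X -> X) (z : Z) (x : X) : X :=
  match z with
  | Z0 => x
  | Zpos p => Nat.iter (Pos.to_nat p) T x
  | Zneg p => Nat.iter (Pos.to_nat p) Tinv x
  end.

(* Main.v *)
(** Write [a i = f (T^i x)]. If the set [S_N] of points with [a (-n) < a (n + q)] for all
    [n > N] had positive measure, it would return to itself with positive measure at some
    time [k > 0]. At such returning points [a (-n)] lies below both [a (n + q)] and
    [a (n + q + 2k)]. Along the two half-orbits the mean frequencies of visits agree, by the
    mean ergodic theorem, so every sublevel set of [f] has the same measure as its union with
    its preimage under [T^(2k)]; hence [f = f o T^(2k)] almost everywhere. But then [a] is
    periodic, so [a i < a (q - i)] holds for all [i], and replacing [i] by [q - i] gives a
    contradiction. Only a weak form of the mean ergodic theorem is needed, with means taken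
    along a Banach limit. *)

Require Import Defs.
From Stdlib Require Import Reals ZArith Lra Lia.
From Stdlib Require Import Classical ClassicalEpsilon.
From Stdlib Require Import FunctionalExtensionality PropExtensionality.
From mathcomp Require filter.
Open Scope R_scope.

(** * Free ultrafilters, Cesaro means and Banach limits *)

(** Any ultrafilter refining the filter of eventual properties will do. Its properties are unpacked
    into plain predicates on [nat], so that the rest of the proof is independent of the filter
    library. *)
Lemma free_ultrafilter_nat : exists G : (nat -> Prop) -> Prop,
  (forall N, G (fun n => (N <= n)%nat)) /\
  ~ G (fun _ => False) /\
  (forall A B : nat -> Prop, (forall n, A n -> B n) -> G A -> G B) /\
  (forall A B, G A -> G B -> G (fun n => A n /\ B n)) /\
  (forall A, G A \/ G (fun n => ~ A n)).
Proof.
destruct (filter.ultraFilterLemma filter.eventually_filter) as [G [HG HsG]].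
pose proof (@filter.ultra_proper _ _ HG) as HP.
pose proof (@filter.filter_filter _ _ HP) as HF.
assert (Hup : forall A B : nat -> Prop, (forall n, A n -> B n) -> G A -> G B).
{ intros A B HAB; exact (@filter.filterS _ _ HF A B HAB). }
exists G; repeat split.
- intros N; apply HsG; exists N; [exact I|].
  intros n Hn; exact (ssrbool.elimT ssrnat.leP Hn).
- exact (@filter.filter_not_empty _ _ HP).
- exact Hup.
- intros A B; exact (@filter.filterI _ _ HF A B).
- intros A; exact (filter.in_ultra_setVsetC A HG).
Qed.

Lemma Rabs_le_bounds (x a : R) : Rabs x <= a -> - a <= x <= a.
Proof. unfold Rabs; destruct (Rcase_abs x); lra. Qed.

Definition bounded_seq (u : nat -> R) : Prop :=
  exists K, forall n, Rabs (u n) <= K.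

Lemma bounded_seq_plus (u v : nat -> R) :
  bounded_seq u -> bounded_seq v -> bounded_seq (fun n => u n + v n).
Proof.
intros [K HK] [K' HK']; exists (K + K'); intros n.
pose proof (Rabs_triang (u n) (v n)); specialize (HK n); specialize (HK' n); lra.
Qed.

Definition cesaro (u : nat -> R) (n : nat) : R := sum_f_R0 u n / INR (S n).

Lemma cesaro_plus (u v : nat -> R) (n : nat) :
  cesaro (fun k => u k + v k) n = cesaro u n + cesaro v n.
Proof. unfold cesaro; rewrite sum_plus; unfold Rdiv; ring. Qed.

Lemma cesaro_const (c : R) (n : nat) : cesaro (fun _ => c) n = c.
Proof.
unfold cesaro; rewrite sum_cte; field.
apply not_0_INR; lia.
Qed.

Lemma cesaro_le (u v : nat -> R) (n : nat) :
  (forall k, u k <= v k) -> cesaro u n <= cesaro v n.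
Proof.
intros H; unfold cesaro, Rdiv; apply Rmult_le_compat_r.
- left; apply Rinv_0_lt_compat, lt_0_INR; lia.
- apply sum_Rle; intros; apply H.
Qed.

Lemma cesaro_bounded (u : nat -> R) : bounded_seq u -> bounded_seq (cesaro u).
Proof.
intros [K HK]; exists K; intros n; apply Rabs_le; split.
- rewrite <- (cesaro_const (- K) n); apply cesaro_le; intros k.
  specialize (HK k); apply Rabs_le_bounds in HK; lra.
- rewrite <- (cesaro_const K n); apply cesaro_le; intros k.
  specialize (HK k); apply Rabs_le_bounds in HK; lra.
Qed.

(** The sums telescope; for bounded [u] the error term tends to 0, which makes limits of Cesaro
    means shift-invariant. *)
Lemma cesaro_shift (u : nat -> R) (n : nat) :
  cesaro (fun k => u (S k)) n = cesaro u n + (u (S n) - u 0%nat) / INR (S n).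
Proof.
assert (E : sum_f_R0 (fun k => u (S k)) n = sum_f_R0 u n + (u (S n) - u 0%nat)).
{ induction n as [|n IH]; simpl; [ring|rewrite IH; simpl; ring]. }
unfold cesaro; rewrite E; unfold Rdiv; ring.
Qed.

(** [L] is a total function, so its laws are restricted to bounded sequences. *)
Definition banach_limit (L : (nat -> R) -> R) : Prop :=
  (forall u v, bounded_seq u -> bounded_seq v ->
     L (fun n => u n + v n) = L u + L v) /\
  (forall u v, bounded_seq u -> bounded_seq v ->
     (forall n, u n <= v n) -> L u <= L v) /\
  (forall c, L (fun _ => c) = c) /\
  (forall u, bounded_seq u -> L (fun n => u (S n)) = L u).

(* Ultrafilter limit of the Cesaro means, which turn a shift into a vanishing error. *)
Lemma banach_limit_exists : exists L, banach_limit L.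
Proof.
destruct free_ultrafilter_nat as [G [Gtail [G0 [Gup [Gand Gult]]]]].
pose (is_ulim := fun (u : nat -> R) (l : R) =>
  forall e, 0 < e -> G (fun n => Rabs (u n - l) < e)).
assert (Gall : forall A : nat -> Prop, (forall n, A n) -> G A).
{ intros A HA; apply (Gup (fun n => (0 <= n)%nat)); auto. }
assert (ulim_ex : forall u, bounded_seq u -> exists l, is_ulim u l).
{ intros u [K HK].
  assert (HK' : forall n, - K <= u n <= K).
  { intros n; specialize (HK n); apply Rabs_le_bounds in HK; lra. }
  (* The limit along [G] is the supremum of the [r] that lie below [u n] for [G]-almost all [n]; the
     dichotomy [Gult] yields both one-sided estimates. *)
  destruct (completeness (fun r => G (fun n => r <= u n))) as [l [Hub Hlub]].
  - exists K; intros r Hr; apply Rnot_lt_le; intros Hlt; apply G0.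
    apply (Gup _ _) with (2 := Hr); intros n; destruct (HK' n); lra.
  - exists (- K); apply Gall; intros n; apply HK'.
  - exists l; intros e He.
    assert (H1 : G (fun n => u n < l + e)).
    { destruct (Gult (fun n => l + e <= u n)) as [H|H].
      - pose proof (Hub _ H); lra.
      - revert H; apply Gup; intros n; lra. }
    assert (H2 : G (fun n => l - e < u n)).
    { destruct (Gult (fun n => l - e < u n)) as [H|H]; [exact H|].
      exfalso; assert (Hle : l <= l - e); [|lra].
      apply Hlub; intros r Hr; apply Rnot_lt_le; intros Hlt; apply G0.
      apply (Gup _ _) with (2 := Gand _ _ H Hr); intros n [? ?]; lra. }
    apply (Gup _ _) with (2 := Gand _ _ H1 H2).
    intros n [? ?]; apply Rabs_def1; lra. }
assert (ulim_le : forall u v a b, is_ulim u a -> is_ulim v b ->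
          (forall n, u n <= v n) -> a <= b).
{ intros u v a b Ha Hb Huv; apply Rnot_lt_le; intros Hlt; apply G0.
  assert (He : 0 < (a - b) / 2) by lra.
  apply (Gup _ _) with (2 := Gand _ _ (Ha _ He) (Hb _ He)).
  intros n [H1 H2]; apply Rabs_def2 in H1, H2; specialize (Huv n); lra. }
assert (ulim_uniq : forall u a b, is_ulim u a -> is_ulim u b -> a = b).
{ intros u a b Ha Hb; apply Rle_antisym;
    [apply (ulim_le u u)|apply (ulim_le u u)]; auto; intros; lra. }
pose (L := fun u => epsilon (inhabits 0) (is_ulim (cesaro u))).
assert (HL : forall u, bounded_seq u -> is_ulim (cesaro u) (L u)).
{ intros u Hu; apply epsilon_spec, ulim_ex, cesaro_bounded, Hu. }
assert (HLconst : forall c, L (fun _ => c) = c).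
{ intros c; apply (ulim_uniq (cesaro (fun _ => c))).
  - apply HL; exists (Rabs c); intros; lra.
  - intros e He; apply Gall; intros n.
    rewrite cesaro_const, Rminus_diag, Rabs_R0; exact He. }
exists L; repeat split.
- intros u v Hu Hv; apply (ulim_uniq (cesaro (fun n => u n + v n))).
  + apply HL, bounded_seq_plus; assumption.
  + intros e He; assert (He2 : 0 < e / 2) by lra.
    apply (Gup _ _) with (2 := Gand _ _ (HL _ Hu _ He2) (HL _ Hv _ He2)).
    intros n [H1 H2]; apply Rabs_def2 in H1, H2.
    rewrite cesaro_plus; apply Rabs_def1; lra.
- intros u v Hu Hv Huv; apply (ulim_le (cesaro u) (cesaro v)); auto.
  intros n; apply cesaro_le, Huv.
- exact HLconst.
- intros u Hu; apply (ulim_uniq (cesaro (fun n => u (S n)))).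
  + apply HL; destruct Hu as [K HK]; exists K; intros; apply HK.
  + pose proof Hu as [K HK].
    intros e He; assert (He2 : 0 < e / 2) by lra.
    (* From index [N] on, the shift error, at most [2 * K / INR (S n)], is below [e / 2]. *)
    destruct (INR_unbounded (4 * K / e)) as [N HN].
    apply (Gup _ _) with (2 := Gand _ _ (HL _ Hu _ He2) (Gtail N)).
    intros n [H1 H2]; apply Rabs_def2 in H1.
    rewrite cesaro_shift.
    assert (Hn : 4 * K / e < INR (S n)).
    { apply Rlt_le_trans with (1 := HN), le_INR; lia. }
    assert (Hpos : 0 < INR (S n)) by (apply lt_0_INR; lia).
    assert (HKe : 4 * K < e * INR (S n)).
    { apply (Rmult_lt_compat_l e) in Hn; [|exact He].
      replace (e * (4 * K / e)) with (4 * K) in Hn by (field; lra); exact Hn. }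
    assert (Hq : Rabs ((u (S n) - u 0%nat) / INR (S n)) < e / 2).
    { unfold Rdiv at 1; rewrite Rabs_mult, (Rabs_right (/ _)).
      2: left; apply Rinv_0_lt_compat; exact Hpos.
      apply (Rmult_lt_reg_r (INR (S n))); [exact Hpos|].
      rewrite Rmult_assoc, Rinv_l, Rmult_1_r by lra.
      pose proof (HK (S n)) as K1; pose proof (HK 0%nat) as K2.
      apply Rabs_le_bounds in K1, K2; apply Rabs_def1; lra. }
    apply Rabs_def2 in Hq; apply Rabs_def1; lra.
Qed.

(** * Sigma-algebras and probability measures *)

(** [M] and [mu] act on predicates, so equivalent descriptions of a set must be made equal before
    they can be exchanged. *)
Lemma pred_ext {X : Type} (A B : X -> Prop) : (forall x, A x <-> B x) -> A = B.
Proof.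
intros H; apply functional_extensionality; intros x.
apply propositional_extensionality, H.
Qed.

Section SigmaAlgebra.

Variables (X : Type) (M : (X -> Prop) -> Prop).
Hypothesis HM : is_sigma_algebra M.

Lemma M_not (A : X -> Prop) : M A -> M (fun x => ~ A x).
Proof. apply HM. Qed.

Lemma M_ex (A : nat -> X -> Prop) :
  (forall n, M (A n)) -> M (fun x => exists n, A n x).
Proof. apply HM. Qed.

(** Used for side conditions on indices alone, such as [i < n], inside set descriptions. *)
Lemma M_const (P : Prop) : M (fun _ => P).
Proof.
destruct (classic P) as [HP|HP].
- rewrite (pred_ext (fun _ : X => P) (fun _ => True)) by (intros x; tauto); apply HM.
- rewrite (pred_ext (fun _ : X => P) (fun _ => ~ True)) by (intros x; tauto); apply M_not, HM.
Qed.

Lemma M_all (A : nat -> X -> Prop) :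
  (forall n, M (A n)) -> M (fun x => forall n, A n x).
Proof.
intros HA; rewrite (pred_ext _ (fun x => ~ exists n, ~ A n x)).
- apply M_not, M_ex; intros n; apply M_not, HA.
- intros x; split.
  + intros H [n Hn]; exact (Hn (H n)).
  + intros H n; apply NNPP; intros Hn; apply H; exists n; exact Hn.
Qed.

Lemma M_or (A B : X -> Prop) : M A -> M B -> M (fun x => A x \/ B x).
Proof.
intros HA HB.
rewrite (pred_ext _ (fun x => exists n : nat, match n with O => A | _ => B end x)).
- apply M_ex; intros [|n]; assumption.
- intros x; split.
  + intros [H|H]; [exists 0%nat|exists 1%nat]; exact H.
  + intros [[|n] H]; tauto.
Qed.

Lemma M_and (A B : X -> Prop) : M A -> M B -> M (fun x => A x /\ B x).
Proof.
intros HA HB; rewrite (pred_ext _ (fun x => ~ (~ A x \/ ~ B x))).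
- apply M_not, M_or; apply M_not; assumption.
- intros x; tauto.
Qed.

Lemma M_imp (P : Prop) (A : X -> Prop) : M A -> M (fun x => P -> A x).
Proof.
intros HA; rewrite (pred_ext _ (fun x => ~ P \/ A x)).
- apply M_or; [apply M_const|exact HA].
- intros x; tauto.
Qed.

Lemma iter_measurable (T : X -> X) (n : nat) :
  measurable_map M T -> measurable_map M (Nat.iter n T).
Proof.
intros HT; induction n as [|n IH]; intros A HA.
- exact HA.
- exact (IH _ (HT _ HA)).
Qed.

Variable mu : (X -> Prop) -> R.
Hypothesis Hmu : is_probability_measure M mu.

Lemma mu_ge0 (A : X -> Prop) : M A -> 0 <= mu A.
Proof. apply Hmu. Qed.

Lemma mu_add (A B : X -> Prop) : M A -> M B -> (forall x, A x -> B x -> False) ->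
  mu (fun x => A x \/ B x) = mu A + mu B.
Proof.
intros HA HB HAB; destruct Hmu as [_ [H0 [Hsum _]]].
(* Countable additivity is applied to [A], [B] and then empty sets; the partial sums are constant
   from index 1 on. *)
pose (F := fun n : nat => match n with O => A | 1%nat => B | _ => fun _ => False end).
assert (E : (fun x => exists n, F n x) = (fun x => A x \/ B x)).
{ apply pred_ext; intros x; split.
  - intros [[|[|n]] H]; simpl in H; tauto.
  - intros [H|H]; [exists 0%nat|exists 1%nat]; exact H. }
assert (HF : infinite_sum (fun n => mu (F n)) (mu (fun x => exists n, F n x))).
{ apply Hsum.
  - intros [|[|n]]; simpl; try assumption; apply M_const.
  - intros [|[|i]] [|[|j]] Hij x; simpl; try tauto; try lia.
    + apply HAB.
    + intros h1 h2; apply (HAB x); assumption. }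
rewrite E in HF; apply eq_sym, (uniqueness_sum _ _ _) with (2 := HF).
intros e He; exists 1%nat; intros n Hn.
replace (sum_f_R0 (fun n => mu (F n)) n) with (mu A + mu B).
- unfold Rdist; rewrite Rminus_diag, Rabs_R0; exact He.
- induction Hn as [|n Hn IH]; [reflexivity|].
  rewrite tech5, <- IH; destruct n; [lia|]; simpl; rewrite H0; ring.
Qed.

Lemma mu_split (A B : X -> Prop) : M A -> M B ->
  mu A = mu (fun x => A x /\ B x) + mu (fun x => A x /\ ~ B x).
Proof.
intros HA HB; rewrite <- mu_add.
- f_equal; apply pred_ext; intros x; tauto.
- apply M_and; assumption.
- apply M_and; [|apply M_not]; assumption.
- tauto.
Qed.

Lemma mu_mono (A B : X -> Prop) : M A -> M B -> (forall x, A x -> B x) -> mu A <= mu B.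
Proof.
intros HA HB HAB; rewrite (mu_split B A) by assumption.
rewrite (pred_ext (fun x => B x /\ A x) A) by (intros x; specialize (HAB x); tauto).
pose proof (mu_ge0 _ (M_and _ _ HB (M_not _ HA))); lra.
Qed.

Lemma mu_le1 (A : X -> Prop) : M A -> mu A <= 1.
Proof.
intros HA; destruct Hmu as [_ [_ [_ <-]]].
apply mu_mono; auto; apply M_const.
Qed.

Lemma mu_bounded_seq (A : nat -> X -> Prop) :
  (forall n, M (A n)) -> bounded_seq (fun n => mu (A n)).
Proof.
intros HA; exists 1; intros n; rewrite Rabs_right.
- apply mu_le1, HA.
- apply Rle_ge, mu_ge0, HA.
Qed.

(** Continuity from above at the empty set: [C 0] is the disjoint union of the differences [D n],
    whose measures have partial sums telescoping to [mu (C 0) - mu (C (S n))]. *)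
Lemma mu_decreasing_empty (C : nat -> X -> Prop) :
  (forall n, M (C n)) -> (forall n x, C (S n) x -> C n x) ->
  (forall x, ~ forall n, C n x) ->
  forall e, 0 < e -> exists n, mu (C n) < e.
Proof.
intros HC Hdec Hempty e He.
pose (D := fun n x => C n x /\ ~ C (S n) x).
assert (Hmon : forall x i j, (i <= j)%nat -> C j x -> C i x).
{ intros x i j Hij; induction Hij; auto. }
assert (ED : (fun x => exists n, D n x) = C 0%nat).
{ apply pred_ext; intros x; split.
  - intros [n [Hn _]]; apply (Hmon x 0%nat n); [lia|exact Hn].
  - intros H0; apply NNPP; intros H; apply (Hempty x); intros n.
    induction n as [|n IH]; [exact H0|].
    apply NNPP; intros Hn; apply H; exists n; split; assumption. }
assert (HD : infinite_sum (fun n => mu (D n)) (mu (C 0%nat))).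
{ rewrite <- ED; apply Hmu.
  - intros n; apply M_and; [|apply M_not]; apply HC.
  - assert (Hlt : forall i j x, (i < j)%nat -> D i x -> D j x -> False).
    { intros i j x Hij [_ H1] [H2 _]; apply H1, (Hmon x (S i) j); [lia|exact H2]. }
    intros i j Hij x Hi Hj; destruct (Nat.lt_gt_cases i j) as [H _].
    destruct (H Hij); [apply (Hlt i j x)|apply (Hlt j i x)]; assumption. }
destruct (HD e He) as [N HN]; specialize (HN N (Nat.le_refl N)).
assert (Htel : forall n, sum_f_R0 (fun n => mu (D n)) n = mu (C 0%nat) - mu (C (S n))).
{ assert (Hstep : forall n, mu (D n) = mu (C n) - mu (C (S n))).
  { intros n; rewrite (mu_split (C n) (C (S n))) by apply HC.
    rewrite (pred_ext (fun x => C n x /\ C (S n) x) (C (S n))).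
    - unfold D; ring.
    - intros x; specialize (Hdec n x); tauto. }
  induction n as [|n IH]; [apply Hstep|].
  rewrite tech5, IH, Hstep; ring. }
rewrite Htel in HN; apply Rabs_def2 in HN; exists (S N); lra.
Qed.

(** The finite unions [F n] are null by induction, and what they miss of the whole union decreases
    to the empty set. *)
Lemma mu_null_union (A : nat -> X -> Prop) :
  (forall n, M (A n)) -> (forall n, mu (A n) = 0) ->
  mu (fun x => exists n, A n x) = 0.
Proof.
intros HA H0.
pose (F := fun n x => exists i, (i < n)%nat /\ A i x).
assert (HF : forall n, M (F n)).
{ intros n; apply M_ex; intros i; apply M_and; [apply M_const|apply HA]. }
assert (HU : M (fun x => exists n, A n x)) by (apply M_ex, HA).
assert (HF0 : forall n, mu (F n) = 0).
{ induction n as [|n IH].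
  - rewrite (pred_ext (F 0%nat) (fun _ => False)); [apply Hmu|].
    intros x; split; [intros [i [Hi _]]; lia|tauto].
  - apply Rle_antisym; [|apply mu_ge0, HF].
    rewrite (mu_split (F (S n)) (F n)) by apply HF.
    assert (H1 := mu_mono _ _ (M_and _ _ (HF (S n)) (HF n)) (HF n) (fun x => @proj2 _ _)).
    assert (H2 : mu (fun x => F (S n) x /\ ~ F n x) <= mu (A n)).
    { apply mu_mono; [apply M_and; [|apply M_not]; apply HF|apply HA|].
      intros x [[i [Hi Hx]] Hn].
      destruct (Nat.eq_dec i n) as [->|Hne]; [exact Hx|].
      exfalso; apply Hn; exists i; split; [lia|exact Hx]. }
    rewrite H0 in H2; lra. }
apply Rle_antisym; [|apply mu_ge0, HU].
apply le_epsilon; intros e He.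
destruct (mu_decreasing_empty (fun n x => (exists n, A n x) /\ ~ F n x)) with (e := e)
  as [n Hn]; auto.
- intros n; apply M_and; [|apply M_not]; auto.
- intros n x [H1 H2]; split; [exact H1|]; intros [i [Hi Hx]]; apply H2.
  exists i; split; [lia|exact Hx].
- intros x H; destruct (H 0%nat) as [[n Hn] _]; apply (H (S n)).
  exists n; split; [lia|exact Hn].
- rewrite (mu_split _ (F n)) by auto.
  assert (mu (fun x => (exists n, A n x) /\ F n x) <= mu (F n)).
  { apply mu_mono; auto; [apply M_and; auto|tauto]. }
  rewrite HF0 in H; lra.
Qed.

(** * Mean ergodic theorem along a Banach limit *)

(* The supremum of [nu - nu(X) mu] is attained at some [P]; it is then also attained at the
   set of points visiting [P] infinitely often, which is invariant, hence trivial. *)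
Lemma invariant_additive_proportional (T : X -> X) (nu : (X -> Prop) -> R) :
  measurable_map M T -> measure_preserving M mu T -> ergodic M mu T ->
  (forall A B, M A -> M B -> (forall x, A x -> B x -> False) ->
     nu (fun x => A x \/ B x) = nu A + nu B) ->
  (forall A, M A -> 0 <= nu A <= mu A) ->
  (forall A, M A -> nu (preimage T A) = nu A) ->
  forall A, M A -> nu A = nu (fun _ => True) * mu A.
Proof.
intros HT Hpres Herg Hadd Hbd Hinv.
set (c := nu (fun _ => True)).
assert (Hc : 0 <= c <= 1).
{ destruct Hmu as [_ [_ [_ E]]]; rewrite <- E; apply Hbd, M_const. }
(* A finitely additive signed set function with total mass 0, dominated by [mu]; the goal is that it
   vanishes. *)
pose (la := fun A => nu A - c * mu A).
assert (la_split : forall A B, M A -> M B ->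
  la A = la (fun x => A x /\ B x) + la (fun x => A x /\ ~ B x)).
{ intros A B HA HB; unfold la; rewrite (mu_split A B) by assumption.
  replace (nu A) with (nu (fun x => A x /\ B x) + nu (fun x => A x /\ ~ B x)); [ring|].
  rewrite <- Hadd; [f_equal; apply pred_ext; intros x; tauto| | |tauto].
  - apply M_and; assumption.
  - apply M_and; [|apply M_not]; assumption. }
assert (la_bd : forall A, M A -> - mu A <= la A <= mu A).
{ intros A HA; pose proof (Hbd A HA); pose proof (mu_ge0 A HA); unfold la; nra. }
assert (laT : la (fun _ => True) = 0).
{ unfold la; destruct Hmu as [_ [_ [_ E]]]; rewrite E; unfold c; ring. }
destruct (completeness (fun r => exists A, M A /\ r = la A)) as [s [Hub Hlub]].
{ exists 1; intros r [A [HA ->]].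
  pose proof (la_bd A HA); pose proof (mu_le1 A HA); lra. }
{ exists (la (fun _ => True)), (fun _ => True); split; [apply M_const|reflexivity]. }
assert (la_le : forall A, M A -> la A <= s).
{ intros A HA; apply Hub; exists A; split; [exact HA|reflexivity]. }
(* By modularity [la (A or B) = la A + la B - la (A and B)], and the intersection has value at most
   [s]. *)
assert (la_union : forall A B, M A -> M B -> la A + la B - s <= la (fun x => A x \/ B x)).
{ intros A B HA HB.
  pose proof (la_split _ _ (M_or _ _ HA HB) HA) as E1.
  pose proof (la_split _ _ HB HA) as E2.
  cbv beta in E1.
  rewrite (pred_ext (fun x => (A x \/ B x) /\ A x) A) in E1 by (intros x; tauto).
  rewrite (pred_ext (fun x => (A x \/ B x) /\ ~ A x) (fun x => B x /\ ~ A x))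
    in E1 by (intros x; tauto).
  pose proof (la_le _ (M_and _ _ HB HA)); lra. }
(* The deficits from [s] are summable, so unions of tails are nearly maximal and their decreasing
   limit is maximal. *)
assert (la_limsup : forall A : nat -> X -> Prop, (forall n, M (A n)) ->
  (forall n, s - (1 / 2) ^ n <= la (A n)) ->
  s <= la (fun x => forall n, exists i, (n <= i)%nat /\ A i x)).
{ intros A HA Hla.
  pose (E := fun n x => exists i, (n <= i)%nat /\ A i x).
  pose (F := fun n j x => exists i, ((n <= i)%nat /\ (i <= n + j)%nat) /\ A i x).
  assert (ME : forall n, M (E n)).
  { intros n; apply M_ex; intros i; apply M_and; [apply M_const|apply HA]. }
  assert (MF : forall n j, M (F n j)).
  { intros n j; apply M_ex; intros i; apply M_and; [apply M_const|apply HA]. }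
  (* By [la_union] deficits add up under unions; the subtracted quantity is the geometric sum of
     [(1 / 2) ^ i] for [i] from [n] to [n + j]. *)
  assert (HF : forall n j, s - (2 * (1 / 2) ^ n - (1 / 2) ^ (n + j)) <= la (F n j)).
  { intros n; induction j as [|j IH].
    - rewrite Nat.add_0_r, (pred_ext (F n 0%nat) (A n)); [specialize (Hla n); lra|].
      intros x; split.
      + intros [i [[H1 H2] H]]; replace n with i by lia; exact H.
      + intros H; exists n; split; [lia|exact H].
    - rewrite (pred_ext (F n (S j)) (fun x => F n j x \/ A (n + S j)%nat x)).
      + pose proof (la_union _ _ (MF n j) (HA (n + S j)%nat)).
        pose proof (Hla (n + S j)%nat) as H1.
        replace (n + S j)%nat with (S (n + j)) in * by lia.
        simpl in *; lra.
      + intros x; split.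
        * intros [i [[H1 H2] H]].
          destruct (Nat.eq_dec i (n + S j)) as [->|Hne]; [right; exact H|].
          left; exists i; split; [lia|exact H].
        * intros [[i [[H1 H2] H]]|H]; [exists i|exists (n + S j)%nat];
            (split; [lia|exact H]). }
  (* [nu] is only finitely additive, but [la] is bounded by [mu] in absolute value, so continuity of
     [mu] lets [j] go to infinity. *)
  assert (HE : forall n, s - 2 * (1 / 2) ^ n <= la (E n)).
  { intros n; apply le_epsilon; intros e He.
    destruct (mu_decreasing_empty (fun j x => E n x /\ ~ F n j x)) with (e := e)
      as [j Hj]; auto.
    - intros j; apply M_and; [|apply M_not]; auto.
    - intros j x [H1 H2]; split; [exact H1|]; intros [i [Hi Hx]]; apply H2.
      exists i; split; [lia|exact Hx].
    - intros x H; destruct (H 0%nat) as [[i [Hi Hx]] _]; apply (H i).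
      exists i; split; [lia|exact Hx].
    - rewrite (la_split _ (F n j)) by auto.
      rewrite (pred_ext (fun x => E n x /\ F n j x) (F n j)).
      + pose proof (la_bd _ (M_and _ _ (ME n) (M_not _ (MF n j)))).
        specialize (HF n j).
        assert (0 < (1 / 2) ^ (n + j)) by (apply pow_lt; lra).
        lra.
      + intros x; split; [tauto|]; intros H; split; [|exact H].
        destruct H as [i [[H1 _] H]]; exists i; split; assumption. }
  change (s <= la (fun x => forall n, E n x)).
  assert (MQ : M (fun x => forall n, E n x)) by (apply M_all, ME).
  assert (Edec : forall n m x, (n <= m)%nat -> E m x -> E n x).
  { intros n m x Hnm [i [Hi Hx]]; exists i; split; [lia|exact Hx]. }
  apply le_epsilon; intros e He.
  (* Half of [e] pays for the measure of [E n] outside the limit set, the other half for the deficit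
     [2 * (1 / 2) ^ (n + m)]; index [n + m] meets both bounds. *)
  destruct (mu_decreasing_empty (fun n x => E n x /\ ~ forall n, E n x))
    with (e := e / 2) as [n Hn]; try lra.
  - intros n; apply M_and; [|apply M_not]; auto.
  - intros n x [H1 H2]; split; [apply (Edec n (S n)); auto|exact H2].
  - intros x H; apply (H 0%nat); intros n; apply (H n).
  - destruct (pow_lt_1_zero (1 / 2)) with (y := e / 4) as [m Hm];
      [rewrite Rabs_right; lra|lra|].
    specialize (Hm (n + m)%nat ltac:(lia)); apply Rabs_def2 in Hm.
    specialize (HE (n + m)%nat).
    rewrite (la_split _ _ (ME (n + m)%nat) MQ) in HE.
    cbv beta in HE.
    rewrite (pred_ext (fun x => E (n + m)%nat x /\ forall n, E n x)
               (fun x => forall n, E n x)) in HE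
      by (intros x; split; [tauto|intros H; split; [apply H|exact H]]).
    pose proof (la_bd _ (M_and _ _ (ME (n + m)%nat) (M_not _ MQ))).
    assert (mu (fun x => E (n + m)%nat x /\ ~ (forall n, E n x))
            <= mu (fun x => E n x /\ ~ (forall n, E n x))).
    { apply mu_mono.
      - apply M_and; [|apply M_not]; auto.
      - apply M_and; [|apply M_not]; auto.
      - intros x [H1 H2]; split; [apply (Edec n (n + m)%nat); [lia|exact H1]|exact H2]. }
    lra. }
assert (Happrox : forall n, exists A, M A /\ s - (1 / 2) ^ n <= la A).
{ intros n; apply NNPP; intros H.
  assert (Hp : 0 < (1 / 2) ^ n) by (apply pow_lt; lra).
  assert (s <= s - (1 / 2) ^ n); [|lra].
  apply Hlub; intros r [A [HA ->]]; apply Rnot_lt_le; intros Hlt.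
  apply H; exists A; split; [exact HA|lra]. }
assert (HP : exists P, M P /\ s <= la P).
{ pose (P := fun n => epsilon (inhabits (fun _ => True))
                        (fun A => M A /\ s - (1 / 2) ^ n <= la A)).
  assert (HPn : forall n, M (P n) /\ s - (1 / 2) ^ n <= la (P n)).
  { intros n; apply (epsilon_spec (inhabits (fun _ : X => True))
      (fun A => M A /\ s - (1 / 2) ^ n <= la A)), Happrox. }
  exists (fun x => forall n, exists i, (n <= i)%nat /\ P i x); split.
  - apply M_all; intros n; apply M_ex; intros i; apply M_and; [apply M_const|apply HPn].
  - apply la_limsup; intros n; apply HPn. }
destruct HP as [P [MP HP]].
pose (Q := fun x => forall n, exists i, (n <= i)%nat /\ preimage (Nat.iter i T) P x).
assert (MTP : forall i, M (preimage (Nat.iter i T) P)).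
{ intros i; apply iter_measurable; assumption. }
assert (MQ : M Q).
{ apply M_all; intros n; apply M_ex; intros i; apply M_and; [apply M_const|apply MTP]. }
(* [la] is invariant under [T], so every preimage of [P] under an iterate attains [s] too and
   [la_limsup] applies. *)
assert (HQ : s <= la Q).
{ apply la_limsup; [exact MTP|].
  assert (Hla : forall i, la (preimage (Nat.iter i T) P) = la P).
  { clear - HT Hpres Hinv MP MTP HM.
    induction i as [|i IH]; [reflexivity|].
    rewrite <- IH; unfold la.
    replace (preimage (Nat.iter (S i) T) P)
      with (preimage T (preimage (Nat.iter i T) P)).
    - rewrite Hpres, Hinv; auto.
    - apply pred_ext; intros x; unfold preimage.
      rewrite Nat.iter_succ_r; tauto. }
  intros n; rewrite Hla.
  assert (0 < (1 / 2) ^ n) by (apply pow_lt; lra); lra. }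
assert (Qinv : forall x, preimage T Q x <-> Q x).
{ intros x; unfold Q, preimage; split; intros H n.
  - destruct (H n) as [i [Hi Hx]]; exists (S i); split; [lia|].
    rewrite Nat.iter_succ_r; exact Hx.
  - destruct (H (S n)) as [[|i] [Hi Hx]]; [lia|]; exists i; split; [lia|].
    rewrite Nat.iter_succ_r in Hx; exact Hx. }
(* If [mu Q = 0] then [nu Q = 0] by domination; if [mu Q = 1] then [nu Q <= c] by monotonicity.
   Either way [la Q <= 0]. *)
assert (Hs : s <= 0).
{ destruct (Herg Q MQ Qinv) as [E|E]; unfold la in HQ; rewrite E in HQ;
    pose proof (Hbd Q MQ) as H; rewrite E in H; [lra|].
  assert (nu Q <= c); [|lra].
  unfold c; rewrite (pred_ext (fun _ => True) (fun x => Q x \/ ~ Q x))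
    by (intros x; pose proof (classic (Q x)); tauto).
  pose proof (M_not _ MQ) as MQ'.
  rewrite Hadd by (auto; tauto).
  pose proof (Hbd _ MQ'); lra. }
(* [la] is nonpositive on [A] and on its complement, with sum 0, hence zero on both. *)
intros A HA.
pose proof (la_split _ _ (M_const True) HA) as E; cbv beta in E; rewrite laT in E.
rewrite (pred_ext (fun x => True /\ A x) A) in E by (intros x; tauto).
rewrite (pred_ext (fun x => True /\ ~ A x) (fun x => ~ A x)) in E by (intros x; tauto).
pose proof (la_le _ HA); pose proof (la_le _ (M_not _ HA)).
unfold la in *; lra.
Qed.

(** As a function of [B] the left side is additive and dominated by [mu]. It is invariant, since
    replacing [B] by its preimage turns the term of index [n + 1] into the old term of index [n],
    and [L] ignores shifts. Its total mass is [mu A]. *)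
Lemma mean_ergodic (T : X -> X) (L : (nat -> R) -> R) :
  banach_limit L ->
  measurable_map M T -> measure_preserving M mu T -> ergodic M mu T ->
  forall A B, M A -> M B ->
  L (fun n => mu (fun x => B x /\ preimage (Nat.iter n T) A x)) = mu A * mu B.
Proof.
intros [Ladd [Lmon [Lconst Lshift]]] HT Hpres Herg A B HA HB.
assert (MA : forall n, M (preimage (Nat.iter n T) A)).
{ intros n; apply iter_measurable; assumption. }
assert (Hiter : forall n, preimage (Nat.iter (S n) T) A
                          = preimage T (preimage (Nat.iter n T) A)).
{ intros n; apply pred_ext; intros x; unfold preimage.
  rewrite Nat.iter_succ_r; tauto. }
assert (MBA : forall C n, M C -> M (fun x => C x /\ preimage (Nat.iter n T) A x)).
{ intros C n HC; apply M_and; auto. }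
assert (Hb : forall C, M C ->
  bounded_seq (fun n => mu (fun x => C x /\ preimage (Nat.iter n T) A x))).
{ intros C HC; apply mu_bounded_seq; auto. }
assert (Hbc : forall c, bounded_seq (fun _ => c)).
{ intros c; exists (Rabs c); intros; lra. }
pose (nu := fun B => L (fun n => mu (fun x => B x /\ preimage (Nat.iter n T) A x))).
change (nu B = mu A * mu B).
rewrite (invariant_additive_proportional T nu); auto.
- f_equal; unfold nu; rewrite <- (Lconst (mu A)); f_equal.
  apply functional_extensionality; intros n.
  rewrite (pred_ext _ (preimage (Nat.iter n T) A)) by (intros x; tauto).
  induction n as [|n IH]; [reflexivity|].
  rewrite Hiter, Hpres; auto.
- intros C D HC HD HCD; unfold nu; rewrite <- Ladd by auto; f_equal.
  apply functional_extensionality; intros n; rewrite <- mu_add; auto.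
  + f_equal; apply pred_ext; intros x; tauto.
  + intros x [H1 _] [H2 _]; exact (HCD x H1 H2).
- intros C HC; split.
  + rewrite <- (Lconst 0); apply Lmon; auto; intros n; apply mu_ge0; auto.
  + rewrite <- (Lconst (mu C)); apply Lmon; auto; intros n; apply mu_mono; auto; tauto.
- intros C HC; unfold nu; rewrite <- Lshift by (apply Hb, HT, HC); f_equal.
  apply functional_extensionality; intros n; rewrite Hiter.
  exact (Hpres _ (MBA C n HC)).
Qed.

End SigmaAlgebra.

(** * Separating real functions by rationals *)

(** Every rational has this form; three natural indices let unions over the rationals be nested
    unions over [nat]. *)
Definition ratio (a b c : nat) : R := (INR a - INR b) / INR (S c).

Lemma ratio_dense (u v : R) : u < v -> exists a b c, u < ratio a b c < v.
Proof.
intros Huv.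
destruct (INR_unbounded (/ (v - u))) as [c Hc].
assert (Hc' : 1 < (v - u) * INR (S c)).
{ assert (/ (v - u) < INR (S c)).
  { apply Rlt_le_trans with (1 := Hc), le_INR; lia. }
  apply (Rmult_lt_compat_l (v - u)) in H; [|lra].
  rewrite Rinv_r in H; lra. }
assert (Hpos : 0 < INR (S c)) by (apply lt_0_INR; lia).
destruct (archimed (u * INR (S c))) as [H1 H2].
set (z := up (u * INR (S c))) in *.
(* [z] is the least integer above [u * INR (S c)], and a step [1 / INR (S c)] is shorter than
   [v - u]. The two naturals are the positive and negative parts of [z]. *)
exists (Z.to_nat z), (Z.to_nat (- z)), c; unfold ratio.
replace (INR (Z.to_nat z) - INR (Z.to_nat (- z))) with (IZR z).
- split; apply (Rmult_lt_reg_r (INR (S c))); auto;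
    unfold Rdiv; rewrite Rmult_assoc, Rinv_l, Rmult_1_r; lra.
- rewrite !INR_IZR_INZ, <- minus_IZR; f_equal; lia.
Qed.

Lemma M_lt {X : Type} (M : (X -> Prop) -> Prop) (f g : X -> R) :
  is_sigma_algebra M -> measurable_fun M f -> measurable_fun M g ->
  M (fun x => f x < g x).
Proof.
intros HM Hf Hg.
rewrite (pred_ext _ (fun x => exists a b c, f x < ratio a b c /\ ~ g x < ratio a b c)).
- apply M_ex; auto; intros a; apply M_ex; auto; intros b; apply M_ex; auto; intros c.
  apply M_and; auto; apply M_not; auto.
- intros x; split.
  + intros H; destruct (ratio_dense _ _ H) as [a [b [c [H1 H2]]]].
    exists a, b, c; split; lra.
  + intros [a [b [c [H1 H2]]]]; lra.
Qed.

(** * Integer powers of an invertible transformation *)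

Section InvertibleSystem.

Variables (X : Type) (M : (X -> Prop) -> Prop) (mu : (X -> Prop) -> R) (T Tinv : X -> X).
Hypotheses (HM : is_sigma_algebra M) (HT : invertible_measurable M T Tinv).

Notation pow := (Tpow T Tinv).

Lemma Tpow_of_nat (n : nat) (x : X) : pow (Z.of_nat n) x = Nat.iter n T x.
Proof.
destruct n as [|n]; [reflexivity|].
unfold Tpow; simpl Z.of_nat; cbv iota.
rewrite SuccNat2Pos.id_succ; reflexivity.
Qed.

Lemma Tpow_opp_of_nat (n : nat) (x : X) : pow (- Z.of_nat n) x = Nat.iter n Tinv x.
Proof.
destruct n as [|n]; [reflexivity|].
simpl; rewrite SuccNat2Pos.id_succ; reflexivity.
Qed.

Lemma Z_of_nat_or_opp (z : Z) :
  exists n, z = Z.of_nat n \/ z = (- Z.of_nat (S n))%Z.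
Proof.
destruct (Z_le_gt_dec 0 z).
- exists (Z.to_nat z); lia.
- exists (pred (Z.to_nat (- z))); lia.
Qed.

Lemma Tpow_succ (z : Z) (x : X) : pow (Z.succ z) x = T (pow z x).
Proof.
destruct HT as [_ [HTV _]].
destruct (Z_of_nat_or_opp z) as [n [-> | ->]].
- rewrite <- Nat2Z.inj_succ, !Tpow_of_nat; reflexivity.
- replace (Z.succ (- Z.of_nat (S n))) with (- Z.of_nat n)%Z by lia.
  rewrite !Tpow_opp_of_nat; simpl; rewrite HTV; reflexivity.
Qed.

Lemma Tpow_pred (z : Z) (x : X) : pow (Z.pred z) x = Tinv (pow z x).
Proof.
destruct HT as [HVT _].
rewrite <- (Z.succ_pred z) at 2; rewrite Tpow_succ, HVT; reflexivity.
Qed.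

Lemma Tpow_add (a b : Z) (x : X) : pow (a + b) x = pow a (pow b x).
Proof.
revert a; apply Z.peano_ind; [reflexivity| |]; intros a IH.
- rewrite Z.add_succ_l, !Tpow_succ, IH; reflexivity.
- rewrite Z.add_pred_l, !Tpow_pred, IH; reflexivity.
Qed.

Lemma Tpow_measurable (z : Z) : measurable_map M (pow z).
Proof.
destruct HT as [_ [_ [H1 H2]]].
destruct (Z_of_nat_or_opp z) as [n [-> | ->]]; intros A HA; unfold preimage.
- rewrite (pred_ext _ (preimage (Nat.iter n T) A))
    by (intros x; rewrite Tpow_of_nat; reflexivity).
  apply iter_measurable; assumption.
- rewrite (pred_ext _ (preimage (Nat.iter (S n) Tinv) A))
    by (intros x; rewrite Tpow_opp_of_nat; reflexivity).
  apply iter_measurable; assumption.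
Qed.

Lemma Tpow_comp_measurable (f : X -> R) (z : Z) :
  measurable_fun M f -> measurable_fun M (fun x => f (pow z x)).
Proof. intros Hf a; exact (Tpow_measurable z _ (Hf a)). Qed.

Lemma inverse_preserving : measure_preserving M mu T -> measure_preserving M mu Tinv.
Proof.
intros Hpres A HA; destruct HT as [HVT [_ [_ H2]]].
rewrite <- (Hpres _ (H2 _ HA)); f_equal; apply pred_ext; intros x.
unfold preimage; rewrite HVT; reflexivity.
Qed.

Lemma inverse_ergodic : ergodic M mu T -> ergodic M mu Tinv.
Proof.
intros Herg A HA Hinv; apply Herg; [exact HA|].
intros x; rewrite <- (Hinv (T x)); unfold preimage.
destruct HT as [HVT _]; rewrite HVT; reflexivity.
Qed.

Lemma Tpow_preserving (z : Z) : measure_preserving M mu T -> measure_preserving M mu (pow z).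
Proof.
intros Hpres; pose proof (inverse_preserving Hpres) as HpresV.
destruct HT as [_ [_ [H1 H2]]].
revert z; apply Z.peano_ind; [intros A HA; reflexivity| |]; intros z IH A HA.
- rewrite <- (Hpres A HA), <- (IH _ (H1 _ HA)); f_equal; apply pred_ext; intros x.
  unfold preimage; rewrite Tpow_succ; reflexivity.
- rewrite <- (HpresV A HA), <- (IH _ (H2 _ HA)); f_equal; apply pred_ext; intros x.
  unfold preimage; rewrite Tpow_pred; reflexivity.
Qed.

(** * Recurrence and comparison of the two half-orbits *)

Hypotheses (Hmu : is_probability_measure M mu) (Hpres : measure_preserving M mu T)
  (Herg : ergodic M mu T).

(** The Banach mean of the measures of [A] met with its preimages is [mu A * mu A > 0], so they
    cannot all vanish for [k > 0]. *)
Lemma positive_recurrence (A : X -> Prop) : M A -> 0 < mu A ->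
  exists k, (0 < k)%nat /\ 0 < mu (fun x => A x /\ preimage (pow (Z.of_nat k)) A x).
Proof.
intros HA Hpos; apply NNPP; intros Hno.
destruct banach_limit_exists as [L HL].
pose proof HL as [_ [_ [Lconst Lshift]]].
assert (MA : forall n, M (fun x => A x /\ preimage (Nat.iter n T) A x)).
{ intros n; apply M_and; auto; apply iter_measurable; auto; apply HT. }
assert (H0 : forall n, mu (fun x => A x /\ preimage (Nat.iter (S n) T) A x) = 0).
{ intros n; apply Rle_antisym; [|eapply mu_ge0; eauto].
  apply Rnot_lt_le; intros H; apply Hno; exists (S n); split; [lia|].
  rewrite (pred_ext _ (fun x => A x /\ preimage (Nat.iter (S n) T) A x)); [exact H|].
  intros x; unfold preimage; rewrite Tpow_of_nat; reflexivity. }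
assert (E : mu A * mu A = 0); [|nra].
rewrite <- (mean_ergodic X M HM mu Hmu T L HL (proj1 (proj2 (proj2 HT)))
              Hpres Herg A A HA HA).
(* The shift drops the term of index 0, which is [mu A] and not 0. *)
rewrite <- Lshift.
- rewrite <- (Lconst 0); f_equal; apply functional_extensionality; exact H0.
- eapply mu_bounded_seq; eauto.
Qed.

(** On [B], each late visit to [A'] in the future forces a visit to [A] in the past. Measuring this
    over [B] and taking Banach means, forward for [T] and backward for [Tinv], gives
    [mu A' * mu B <= mu A * mu B]. *)
Lemma reflected_inclusion_measure_le (A A' B : X -> Prop) (q : Z) (N : nat) :
  M A -> M A' -> M B -> 0 < mu B ->
  (forall n x, (N < n)%nat -> B x ->
     A' (pow (Z.of_nat n + q) x) -> A (pow (- Z.of_nat n) x)) ->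
  mu A' <= mu A.
Proof.
intros HA HA' HB Hpos Himp.
destruct banach_limit_exists as [L HL].
pose proof HL as [_ [Lmon [_ Lshift]]].
(* Absorbs the offset [q], so that forward times are plain naturals. *)
pose (A'' := preimage (pow q) A').
assert (HA'' : M A'') by (apply Tpow_measurable, HA').
pose proof (mu_bounded_seq X M HM mu Hmu) as bd.
assert (M1 : forall n, M (fun x => B x /\ preimage (Nat.iter n T) A'' x)).
{ intros n; apply M_and; auto; apply iter_measurable; auto; apply HT. }
assert (M2 : forall n, M (fun x => B x /\ preimage (Nat.iter n Tinv) A x)).
{ intros n; apply M_and; auto; apply iter_measurable; auto; apply HT. }
assert (Lshifts : forall m u, bounded_seq u -> L (fun n => u (m + n)%nat) = L u).
{ induction m as [|m IH]; intros u Hu; [reflexivity|].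
  rewrite <- (Lshift u Hu), <- (IH (fun n => u (S n))); [reflexivity|].
  destruct Hu as [K HK]; exists K; auto. }
pose proof (mean_ergodic X M HM mu Hmu T L HL (proj1 (proj2 (proj2 HT)))
              Hpres Herg A'' B HA'' HB) as E1.
pose proof (mean_ergodic X M HM mu Hmu Tinv L HL (proj2 (proj2 (proj2 HT)))
              (inverse_preserving Hpres) (inverse_ergodic Herg) A B HA HB) as E2.
unfold A'' in E1 at 2; rewrite (Tpow_preserving q Hpres A' HA') in E1.
(* Discards the times [n <= N], where the implication is not assumed. *)
rewrite <- (Lshifts (S N)) in E1, E2 by (apply bd; assumption).
assert (Hle : mu A' * mu B <= mu A * mu B).
{ rewrite <- E1, <- E2; apply Lmon.
  - apply (bd (fun n x => B x /\ preimage (Nat.iter (S N + n) T) A'' x)); auto.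
  - apply (bd (fun n x => B x /\ preimage (Nat.iter (S N + n) Tinv) A x)); auto.
  - intros n; eapply mu_mono; eauto.
    intros x [Hx Hi]; split; [exact Hx|].
    unfold preimage; rewrite <- Tpow_opp_of_nat; apply Himp; [lia|exact Hx|].
    unfold A'', preimage in Hi; rewrite <- Tpow_of_nat, <- Tpow_add, Z.add_comm in Hi.
    exact Hi. }
apply Rmult_le_reg_r with (2 := Hle); exact Hpos.
Qed.

(** * The sets [eventually_below N] are null *)

Variables (f : X -> R) (q : Z).
Hypothesis Hf : measurable_fun M f.

Definition eventually_below (N : nat) (x : X) : Prop :=
  forall n, (N < n)%nat -> f (pow (- Z.of_nat n) x) < f (pow (Z.of_nat n + q) x).

Lemma eventually_below_measurable (N : nat) : M (eventually_below N).
Proof.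
unfold eventually_below; apply M_all; auto; intros n; apply M_imp; auto.
apply M_lt; auto; apply Tpow_comp_measurable, Hf.
Qed.

(** Modulo the period, the reflection [i -> q - i] exchanges the two sides of the inequality; it is
    applied at two times beyond [N] that reflect to each other. *)
Lemma not_eventually_below_periodic (N p : nat) (x : X) : (0 < p)%nat ->
  (forall i, f (pow (i + Z.of_nat p) x) = f (pow i x)) -> ~ eventually_below N x.
Proof.
intros Hp Hper Hx.
assert (Hper' : forall m i, f (pow (i + Z.of_nat m * Z.of_nat p) x) = f (pow i x)).
{ induction m as [|m IH]; intros i.
  - f_equal; f_equal; lia.
  - rewrite <- (IH i), <- (Hper (i + Z.of_nat m * Z.of_nat p)%Z).
    f_equal; f_equal; lia. }
(* Large enough that [n'], the reflection of [S N] moved by [m] periods, exceeds [N]. *)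
set (m := (2 * N + 2 + Z.to_nat (Z.abs q))%nat).
set (n' := (Z.of_nat m * Z.of_nat p - (Z.of_nat (S N) + q))%Z).
assert (Hn' : (Z.of_nat N < n')%Z) by (unfold n', m; nia).
pose proof (Hx (S N) (Nat.lt_succ_diag_r N)) as H1.
pose proof (Hx (Z.to_nat n') ltac:(lia)) as H2.
rewrite Z2Nat.id in H2 by lia.
rewrite <- (Hper' m (- n')%Z) in H2.
replace (- n' + Z.of_nat m * Z.of_nat p)%Z with (Z.of_nat (S N) + q)%Z in H2
  by (unfold n'; ring).
replace (n' + q)%Z with (- Z.of_nat (S N) + Z.of_nat m * Z.of_nat p)%Z in H2
  by (unfold n'; ring).
rewrite Hper' in H2; lra.
Qed.

(** Where [g] and [f] differ, some rational lies strictly between them, so countably many null sets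
    cover. *)
Lemma sublevel_null_difference_ae_eq (g : X -> R) : measurable_fun M g ->
  (forall c, mu (fun x => g x < c /\ ~ f x < c) = 0) ->
  (forall c, mu (fun x => f x < c /\ ~ g x < c) = 0) ->
  mu (fun x => g x <> f x) = 0.
Proof.
intros Hg H1 H2.
rewrite (pred_ext _ (fun x => exists a b c,
  g x < ratio a b c /\ ~ f x < ratio a b c \/ f x < ratio a b c /\ ~ g x < ratio a b c)).
- assert (MD : forall r, M (fun x => g x < r /\ ~ f x < r \/ f x < r /\ ~ g x < r)).
  { intros r; apply M_or; auto; apply M_and; auto; apply M_not; auto. }
  assert (MD2 : forall a b, M (fun x => exists c,
    g x < ratio a b c /\ ~ f x < ratio a b c \/ f x < ratio a b c /\ ~ g x < ratio a b c)).
  { intros a b; apply M_ex; auto. }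
  apply (mu_null_union X M HM mu Hmu); [intros a; apply M_ex; auto|]; intros a.
  apply (mu_null_union X M HM mu Hmu); [auto|]; intros b.
  apply (mu_null_union X M HM mu Hmu); [auto|]; intros c.
  rewrite (mu_add X M HM mu Hmu).
  + rewrite H1, H2; ring.
  + apply M_and; auto; apply M_not; auto.
  + apply M_and; auto; apply M_not; auto.
  + tauto.
- intros x; split.
  + intros H; destruct (Rtotal_order (g x) (f x)) as [Hlt|[Heq|Hlt]];
      [|contradiction|]; destruct (ratio_dense _ _ Hlt) as [a [b [c Hr]]];
      exists a, b, c; lra.
  + intros [a [b [c Hr]]]; lra.
Qed.

(* A return of [eventually_below N] to itself at time [k] bounds [f (T^-n x)] by both
   [f (T^(n+q) x)] and [f (T^(n+q+2k) x)], so no sublevel set of [f] can grow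
   when its preimage by [T^(2k)] is added to it. *)
Lemma eventually_below_null (N : nat) : mu (eventually_below N) = 0.
Proof.
pose proof (eventually_below_measurable N) as MS.
apply Rle_antisym; [|eapply mu_ge0; eauto].
apply Rnot_lt_le; intros Hpos.
destruct (positive_recurrence _ MS Hpos) as [k [Hk HB]].
set (B := fun x => eventually_below N x /\ preimage (pow (Z.of_nat k)) (eventually_below N) x)
  in HB.
assert (MB : M B) by (apply M_and; auto; apply Tpow_measurable; auto).
pose (p := (2 * k)%nat).
pose (g := fun x => f (pow (Z.of_nat p) x)).
assert (Hg : measurable_fun M g) by (apply Tpow_comp_measurable, Hf).
assert (Hle : forall c, mu (fun x => f x < c \/ g x < c) <= mu (fun x => f x < c)).
{ intros c; apply (reflected_inclusion_measure_le _ _ B q N); auto.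
  - apply M_or; auto.
  - intros n x Hn [Hx1 Hx2] [H|H].
    + pose proof (Hx1 n Hn); lra.
    + unfold preimage in Hx2.
      (* For the point [T^k x], time [n + k] looks back to [T^(-n) x] and forward to
         [T^(n + q + 2k) x]. *)
      pose proof (Hx2 (n + k)%nat ltac:(lia)) as H3.
      unfold g in H; rewrite <- !Tpow_add in *.
      replace (- Z.of_nat (n + k) + Z.of_nat k)%Z with (- Z.of_nat n)%Z in H3 by lia.
      replace (Z.of_nat (n + k) + q + Z.of_nat k)%Z
        with (Z.of_nat p + (Z.of_nat n + q))%Z in H3 by (unfold p; lia).
      lra. }
assert (Hgf : forall c, mu (fun x => g x < c) = mu (fun x => f x < c)).
{ intros c; exact (Tpow_preserving (Z.of_nat p) Hpres _ (Hf c)). }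
assert (MD1 : forall c, M (fun x => g x < c /\ ~ f x < c)).
{ intros c; apply M_and; auto; apply M_not; auto. }
assert (MD2 : forall c, M (fun x => f x < c /\ ~ g x < c)).
{ intros c; apply M_and; auto; apply M_not; auto. }
assert (HD1 : forall c, mu (fun x => g x < c /\ ~ f x < c) = 0).
{ intros c; pose proof (Hle c) as H.
  rewrite (pred_ext _ (fun x => f x < c \/ (g x < c /\ ~ f x < c))) in H
    by (intros x; tauto).
  rewrite (mu_add X M HM mu Hmu) in H; auto; [|tauto].
  pose proof (mu_ge0 X M mu Hmu _ (MD1 c)); lra. }
(* The sublevel sets of [f] and [g] have equal measure, so if one difference is null, so is the
   other. *)
assert (HD2 : forall c, mu (fun x => f x < c /\ ~ g x < c) = 0).
{ intros c; pose proof (mu_split X M HM mu Hmu _ _ (Hf c) (Hg c)) as E1.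
  pose proof (mu_split X M HM mu Hmu _ _ (Hg c) (Hf c)) as E2.
  cbv beta in E1, E2; rewrite HD1, Hgf in E2.
  rewrite (pred_ext (fun x => g x < c /\ f x < c) (fun x => f x < c /\ g x < c)) in E2
    by (intros x; tauto).
  lra. }
pose (W := fun x => g x <> f x).
assert (W0 : mu W = 0) by (apply sublevel_null_difference_ae_eq; auto).
assert (MW : M W).
{ unfold W; rewrite (pred_ext _ (fun x => g x < f x \/ f x < g x)).
  - apply M_or; auto; apply M_lt; auto.
  - intros x; split; [apply Rdichotomy|lra]. }
(* All integer translates of [W], the integer written as [a - b]; off their union the values of [f]
   along the orbit are [p]-periodic. *)
pose (V := fun a b x => preimage (pow (Z.of_nat a - Z.of_nat b)) W x).
assert (MV : forall a b, M (V a b)) by (intros a b; apply Tpow_measurable, MW).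
assert (MV' : forall a, M (fun x => exists b, V a b x)) by (intros a; apply M_ex; auto).
assert (V0 : mu (fun x => exists a b, V a b x) = 0).
{ apply (mu_null_union X M HM mu Hmu); auto; intros a.
  apply (mu_null_union X M HM mu Hmu); auto; intros b.
  rewrite <- W0; apply (Tpow_preserving _ Hpres _ MW). }
assert (Hle0 : mu (eventually_below N) <= mu (fun x => exists a b, V a b x)); [|lra].
eapply mu_mono; eauto; [apply M_ex; auto|].
intros x Hx; apply NNPP; intros Hno.
apply (not_eventually_below_periodic N p x); [unfold p; lia| |exact Hx].
intros i; apply NNPP; intros Hi; apply Hno.
exists (Z.to_nat i), (Z.to_nat (- i)); unfold V, W, g, preimage.
replace (Z.of_nat (Z.to_nat i) - Z.of_nat (Z.to_nat (- i)))%Z with i by lia.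
rewrite <- Tpow_add, Z.add_comm; exact Hi.
Qed.

End InvertibleSystem.

Theorem theorem5 (X : Type) (M : (X -> Prop) -> Prop) (mu : (X -> Prop) -> R)
    (T Tinv : X -> X) (f : X -> R) (q : Z)
    (HM : is_sigma_algebra M)
    (Hmu : is_probability_measure M mu)
    (HT : invertible_measurable M T Tinv)
    (Hpres : measure_preserving M mu T)
    (Herg : ergodic M mu T)
    (Hf : measurable_fun M f) :
  let S := fun x : X => exists N : nat, (0 < N)%nat /\
             forall n : nat, (N < n)%nat ->
               f (Tpow T Tinv (- Z.of_nat n)%Z x) < f (Tpow T Tinv (Z.of_nat n + q)%Z x) in
  M S /\ mu S = 0.
Proof.
intros S.
(* The condition [0 < N] goes into the set, so that the union runs over all of [nat]. *)
pose (SN := fun N x => (0 < N)%nat /\ eventually_below X T Tinv f q N x).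
assert (MSN : forall N, M (SN N)).
{ intros N; apply M_and; [exact HM|apply M_const, HM|].
  apply eventually_below_measurable; assumption. }
change (M (fun x => exists N, SN N x) /\ mu (fun x => exists N, SN N x) = 0).
split; [apply M_ex; assumption|].
apply (mu_null_union X M HM mu Hmu); [exact MSN|]; intros N.
apply Rle_antisym; [|apply (mu_ge0 X M mu Hmu), MSN].
rewrite <- (eventually_below_null X M mu T Tinv HM HT Hmu Hpres Herg f q Hf N).
apply (mu_mono X M HM mu Hmu); [apply MSN| |intros x [_ H]; exact H].
apply eventually_below_measurable; assumption.
Qed.
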